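(* Given an instance of \textsc{OraclePureCircuit} with $|V|$ nodes, any algorithm that has black-box oracle access to $\mathcal{L}$ and outputs a solution to \textsc{OraclePureCircuit} requires $2^{\Omega(|V|^{1/3})}$ queries to $\mathcal{L}$ (in the worst case).
   Context: \textsc{OraclePureCircuit}: An instance is given by a natural number $N$, a finite set of nodes $V$ (with $N\le|V|$), three sets of gates $\mathcal{G}_{\textsc{Nor}}$, $\mathcal{G}_{\textsc{Purify}}$, $\mathcal{G}_{\textsc{Oracle}}$, and oracle access to a function $\mathcal{L}:\{0,1\}^N\to\{0,1\}$. Each gate is a tuple of distinct nodes: $(u,v,w)\in\mathcal{G}_{\textsc{Nor}}$ has inputs $u,v$ and output $w$; $(u,v,w)\in\mathcal{G}_{\textsc{Purify}}$ has input $u$ and outputs $v,w$; $(u_1,\dots,u_N,v)\in\mathcal{G}_{\textsc{Oracle}}$ has inputs $u_1,\dots,u_N$ and output $v$. Each node is the output of exactly one gate. A solution is an assignment $b:V\to\{0,1,\bot\}$ satisfying all gates: for $(u,v,w)\in\mathcal{G}_{\textsc{Nor}}$, $b(u)=b(v)=0\implies b(w)=1$, and ($b(u)=1$ or $b(v)=1$) $\implies b(w)=0$; for $(u,v,w)\in\mathcal{G}_{\textsc{Purify}}$, $\{b(v),b(w)\}\cap\{0,1\}\ne\emptyset$, and $b(u)\in\{0,1\}\implies b(v)=b(w)=b(u)$; for $(u_1,\dots,u_N,v)\in\mathcal{G}_{\textsc{Oracle}}$, $(b(u_1),\dots,b(u_N))\in\{0,1\}^N\implies b(v)=\mathcal{L}(b(u_1),\dots,b(u_N))$.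 *)

(* Defs.v *)
From HB Require Import structures.
From mathcomp Require Import all_boot all_order all_algebra.
From mathcomp Require Import reals exp.

Set Implicit Arguments.
Unset Strict Implicit.
Unset Printing Implicit Defensive.

(* The part of an instance that is given explicitly; the function
   {0,1}^N -> {0,1} is kept apart, since it is only accessible by queries.
   A triple (u, v, w) is encoded as ((u, v), w). *)
Record circuit := Circuit {
  arity : nat;
  node : finType;
  nor_gates : {set node * node * node};
  purify_gates : {set node * node * node};
  oracle_gates : {set arity.-tuple node * node};
  arity_le : arity <= #|node|;
  nor_distinct : forall u v w, (u, v, w) \in nor_gates -> uniq [:: u; v; w];
  purify_distinct :
    forall u v w, (u, v, w) \in purify_gates -> uniq [:: u; v; w];
  oracle_distinct :
    forall (us : arity.-tuple node) v,
      (us, v) \in oracle_gates -> uniq (rcons us v);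
  (* exactly one gate, of any of the three kinds, has x among its outputs *)
  output_unique : forall x : node,
    #|[set g in nor_gates | g.2 == x]|
    + #|[set g in purify_gates | (g.1.2 == x) || (g.2 == x)]|
    + #|[set g in oracle_gates | g.2 == x]| = 1
}.

Definition oracle (C : circuit) := (arity C).-tuple bool -> bool.

(* [Some false], [Some true] and [None] stand for 0, 1 and bottom. *)
Definition assignment (C : circuit) := node C -> option bool.

Definition nor_ok (C : circuit) (b : assignment C) (u v w : node C) : Prop :=
  (b u = Some false /\ b v = Some false -> b w = Some true) /\
  (b u = Some true \/ b v = Some true -> b w = Some false).

Definition purify_ok (C : circuit) (b : assignment C) (u v w : node C) : Prop :=
  (b v <> None \/ b w <> None) /\
  (forall x : bool, b u = Some x -> b v = Some x /\ b w = Some x).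

Definition oracle_ok (C : circuit) (L : oracle C) (b : assignment C)
    (us : (arity C).-tuple (node C)) (v : node C) : Prop :=
  forall x : (arity C).-tuple bool,
    (forall i : 'I_(arity C), b (tnth us i) = Some (tnth x i)) ->
    b v = Some (L x).

Definition is_solution (C : circuit) (L : oracle C) (b : assignment C) : Prop :=
  [/\ forall u v w, (u, v, w) \in nor_gates C -> nor_ok b u v w,
      forall u v w, (u, v, w) \in purify_gates C -> purify_ok b u v w &
      forall us v, (us, v) \in oracle_gates C -> oracle_ok L b us v].

(* Adaptive query strategies: the next query, and the final output, may depend
   arbitrarily on the answers received so far. *)
Inductive query_tree (X Y : Type) : Type :=
| Output of Y
| Query of X & (bool -> query_tree X Y).

Fixpoint run (X Y : Type) (t : query_tree X Y) (L : X -> bool) : Y :=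
  match t with
  | Output y => y
  | Query x k => run (k (L x)) L
  end.

Fixpoint num_queries (X Y : Type) (t : query_tree X Y) (L : X -> bool) : nat :=
  match t with
  | Output _ => 0
  | Query x k => (num_queries (k (L x)) L).+1
  end.

(* The algorithm sees the whole circuit for free; only queries are counted. *)
Definition algorithm :=
  forall C : circuit, query_tree ((arity C).-tuple bool) (assignment C).

Definition solves_OraclePureCircuit (A : algorithm) : Prop :=
  forall (C : circuit) (L : oracle C), is_solution L (run (A C) L).

(* Main.v *)
Require Import Defs.
From HB Require Import structures.
From mathcomp Require Import all_boot all_order all_algebra.
From mathcomp Require Import boolp reals exp.
From mathcomp Require Import zify.

(* The circuit turns each of K = 2k + 2 nodes x_i, by a chain of PURIFY gates,
   into 18 bits of which at most one is impure, and each of these bits into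
   2K + 1 copies of which at most one is impure.  Counting ones, at least K + 1
   of the 2K + 1 samples are points of a common unit cell of {0,...,18}^K.
   Oracle gates compute the i-th label at every sample, and a threshold circuit
   feeds their majority back into x_i.  If all pure samples had the same i-th
   label, then x_i would be that label and all samples would lie on the
   corresponding face of the cube, where the label is the opposite one.  So a
   solution yields a unit cell in which every label takes both values, that is,
   a discrete zero of a vector field.  There are O(k^3) nodes.

   The field hides a path that starts at the vertex 0 of {0,1}^k.  A point is
   (x, y, rho, tau) with x, y in the cube.  Along an edge u -> w of the path runs
   a tube which, while it circles once in the (rho, tau)-plane, first moves y
   from u to w and then x from u to w.  Far from all tubes the field points to x =
   y = 0 and to the center of the plane, which is where the path starts, so that
   zeros occur only at the end of the path.  An adversary who lengthens the path
   by a fresh vertex whenever a query touches its end spends two vertices per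
   query, hence survives 2^(k-2) queries. *)

Set Implicit Arguments.
Unset Strict Implicit.
Unset Printing Implicit Defensive.

(** * Planar vector fields, checked cell by cell by computation *)

Definition field := nat -> nat -> bool * bool.

Definition rest_field : field := fun r t => (r < 6, t < 6).

(* Row tau, column rho; the code is 2 [rho increases] + [tau increases].  Around
   the core, where this is [rest_field], lie four rings.  From the outside in,
   the field there points inward and clockwise, outward and clockwise, outward
   and anticlockwise, inward and anticlockwise.  It thus makes a full turn
   across the rings, which is the degree that a tube has to carry. *)
Definition tube_rows : seq (seq nat) := [::
  [:: 3; 1; 1; 1; 1; 1; 1; 1; 1; 1; 1; 1];
  [:: 3; 1; 0; 0; 0; 0; 0; 0; 0; 0; 0; 0];
  [:: 3; 1; 0; 2; 2; 2; 2; 2; 2; 2; 2; 0];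
  [:: 3; 1; 0; 2; 3; 3; 3; 3; 3; 3; 2; 0];
  [:: 3; 1; 0; 2; 3; 3; 1; 1; 1; 3; 2; 0];
  [:: 3; 1; 0; 2; 3; 3; 1; 1; 1; 3; 2; 0];
  [:: 3; 1; 0; 2; 2; 2; 0; 0; 1; 3; 2; 0];
  [:: 3; 1; 0; 2; 2; 2; 0; 0; 1; 3; 2; 0];
  [:: 3; 1; 0; 2; 2; 2; 0; 0; 1; 3; 2; 0];
  [:: 3; 1; 0; 2; 2; 2; 0; 0; 1; 3; 2; 0];
  [:: 3; 1; 0; 2; 2; 2; 0; 0; 1; 3; 2; 0];
  [:: 3; 1; 0; 2; 2; 2; 0; 0; 1; 3; 2; 0];
  [:: 3; 1; 0; 2; 2; 2; 0; 0; 1; 3; 2; 0];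
  [:: 3; 1; 0; 2; 2; 2; 0; 0; 1; 3; 2; 0];
  [:: 3; 1; 0; 2; 2; 2; 0; 0; 1; 3; 2; 0];
  [:: 3; 1; 0; 0; 0; 0; 0; 0; 1; 3; 2; 0];
  [:: 3; 1; 1; 1; 1; 1; 1; 1; 1; 3; 2; 0];
  [:: 3; 3; 3; 3; 3; 3; 3; 3; 3; 3; 2; 0];
  [:: 2; 2; 2; 2; 2; 2; 2; 2; 2; 2; 2; 0]].

(** The default 4 is no code: outside the table the field is [rest_field]. *)
Definition tube_field : field := fun r t =>
  let c := nth 4 (nth [::] tube_rows t) r in
  if c < 4 then (1 < c, odd c) else rest_field r t.

(* At the start of the path, the flow has to leave the cell {5,6}^2, where
   [rest_field] vanishes, and enter the rings on the left. *)
Definition start_field : field := fun r t =>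
  if 6 < t then if r < 6 then tube_field r t else rest_field r t
  else if t == 6 then (r == 0, r <= 1)
  else if t == 5 then (r == 0, true)
  else rest_field r t.

(* The field has no zero in the cell {r, r+1} x {t, t+1}. *)
Definition consistent (F : field) r t :=
  let s := [:: F r t; F r t.+1; F r.+1 t; F r.+1 t.+1] in
  constant (map fst s) || constant (map snd s).

Definition eq_on_cell (F G : field) r t :=
  [&& F r t == G r t, F r t.+1 == G r t.+1,
      F r.+1 t == G r.+1 t & F r.+1 t.+1 == G r.+1 t.+1].

Lemma all_cells (P : nat -> nat -> bool) :
  all (fun r => all (P r) (iota 0 19)) (iota 0 19) ->
  forall r t, r <= 18 -> t <= 18 -> P r t.
Proof.
move=> /allP H r t Hr Ht.
have /H /allP : r \in iota 0 19 by rewrite mem_iota.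
by apply; rewrite mem_iota.
Qed.

Lemma rest_consistent r t : r <= 18 -> t <= 18 ->
  (r == 5) && (t == 5) || consistent rest_field r t.
Proof. by move: r t; apply: all_cells; vm_compute. Qed.

Lemma tube_consistent r t : r <= 18 -> t <= 18 ->
  (r == 5) && (t == 5) || consistent tube_field r t.
Proof. by move: r t; apply: all_cells; vm_compute. Qed.

(** The exempted ray is the seam where the left half of [tube_field] is glued to [rest_field]; its
    cells are treated in [escapes_middle] and [escapes_top]. *)
Lemma start_consistent r t : r <= 18 -> t <= 18 ->
  (r == 5) && (6 < t) || consistent start_field r t.
Proof. by move: r t; apply: all_cells; vm_compute. Qed.

(** Near the hole active and inactive points can share a cell, so the two fields have to coincide
    there. *)
Lemma tube_rest_near_hole r t : r <= 18 -> t <= 18 ->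
  (4 <= r <= 6) && (4 <= t <= 6) ==> eq_on_cell tube_field rest_field r t.
Proof. by move: r t; apply: all_cells; vm_compute. Qed.

(** At intermediate progress the tubes on the two sides of this seam need not match. Since all
    fields are [rest_field] there, it does not matter which one a point sees. *)
Lemma fields_above_hole r t : r <= 18 -> t <= 18 ->
  (r == 5) && (6 < t < 14) ==>
  eq_on_cell tube_field rest_field r t && eq_on_cell start_field rest_field r t.
Proof. by move: r t; apply: all_cells; vm_compute. Qed.

Definition inward_at_border (F : field) :=
  forall a, a <= 18 ->
  [/\ (F 0 a).1, ~~ (F 18 a).1, (F a 0).2 & ~~ (F a 18).2].

Lemma border_check (F : field) :
  all (fun a => [&& (F 0 a).1, ~~ (F 18 a).1, (F a 0).2 & ~~ (F a 18).2])
    (iota 0 19) ->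
  inward_at_border F.
Proof.
move=> /allP H a Ha; apply/and4P; apply: H.
by rewrite mem_iota.
Qed.

Lemma rest_border : inward_at_border rest_field.
Proof. by apply: border_check; vm_compute. Qed.

Lemma tube_border : inward_at_border tube_field.
Proof. by apply: border_check; vm_compute. Qed.

Lemma start_border : inward_at_border start_field.
Proof. by apply: border_check; vm_compute. Qed.

(** * The labelling of the grid by a path system *)

Section Labels.

Variable k : nat.

Let vertex := {ffun 'I_k -> bool}.
(* [inl (false, j)] and [inl (true, j)] are the coordinates of x and of y;
   [inr false] and [inr true] are rho and tau. *)
Definition axis := (bool * 'I_k + bool)%type.
Let point := axis -> nat.

Definition origin : vertex := [ffun=> false].

Record path_system := PathSystem {
  path_next : vertex -> option vertex;
  path_prev : vertex -> option vertex;
  path_end : vertex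
}.

Definition path_system_wf (l : path_system) : Prop :=
  [/\ forall u w, path_next l u = Some w <-> path_prev l w = Some u,
      path_prev l origin = None &
      forall u, u != path_end l ->
        isSome (path_next l u) = (u == origin) || isSome (path_prev l u)].

Definition decode (p : point) (s : bool) : vertex := [ffun j => 4 < p (inl (s, j))].

Definition rho (p : point) := p (inr false).
Definition tau (p : point) := p (inr true).
Definition progress (p : point) := minn 7 (tau p - 7).
Definition in_hole (p : point) := (5 <= rho p <= 6) && (5 <= tau p <= 6).

(* The tube (v, u, w) of an edge u -> w has its center at (v, v) when the
   progress is 0 and at (u, w) when it is 7. On the left half y moves from u to
   w as tau increases, with v = u; on the right half x moves from u to w as tau
   decreases, with v = w. *)
Definition tube (l : path_system) (p : point) : option (vertex * vertex * vertex) :=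
  if in_hole p then Some (origin, origin, origin)
  else if rho p < 6 then
    let u := decode p false in omap (fun w => (u, u, w)) (path_next l u)
  else
    let w := decode p true in
    if w == origin then Some (origin, origin, origin)
    else omap (fun u => (w, u, w)) (path_prev l w).

(* Bits 0 and 1 sit at the positions 1 and 8 of {0,...,18}. *)
Definition slide (h : nat) (b b' : bool) := 1 + b * (7 - h) + b' * h.

Definition center (c : vertex * vertex * vertex) (h : nat) (s : bool * 'I_k) :=
  slide h (c.1.1 s.2) ((if s.1 then c.2 else c.1.2) s.2).

Definition near (p : point) (c : vertex * vertex * vertex) :=
  [forall s, (p (inl s) <= center c (progress p) s + 2)
          && (center c (progress p) s <= p (inl s) + 2)].

Definition plane_field (l : path_system) (p : point) : field :=
  if tube l p is Some c then
    if near p c then if c.1.1 == origin then start_field else tube_field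
    else rest_field
  else rest_field.

Definition label (l : path_system) (p : point) (i : axis) : bool :=
  match i with
  | inl s =>
    p (inl s) < (if tube l p is Some c then center c (progress p) s else 1)
  | inr b =>
    let q := plane_field l p (rho p) (tau p) in if b then q.2 else q.1
  end.

Lemma progress_le p : progress p <= 7.
Proof. by rewrite /progress; lia. Qed.

Lemma slide_bounds h b b' : h <= 7 -> 1 <= slide h b b' <= 8.
Proof. by rewrite /slide; case: b b' => [] [] /=; lia. Qed.

Lemma center_bounds c p s : 1 <= center c (progress p) s <= 8.
Proof. exact/slide_bounds/progress_le. Qed.

Lemma label_border l p i : (forall i, p i <= 18) ->
  (p i = 0 -> label l p i) /\ (p i = 18 -> ~~ label l p i).
Proof.
move=> Hp.
have Hf : inward_at_border (plane_field l p).
  rewrite /plane_field; case: (tube l p) => [c|]; last exact: rest_border.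
  case: ifP => _; last exact: rest_border.
  by case: ifP => _; [exact: start_border | exact: tube_border].
case: i => [s|[]] /=.
- case: (tube l p) => [c|]; last by split=> ->.
  by have := center_bounds c p s; split=> ->; lia.
- have [_ _ H0 H1] := Hf (rho p) (Hp _).
  by rewrite /tau; split=> ->.
- have [H0 H1 _ _] := Hf (tau p) (Hp _).
  by rewrite /rho; split=> ->.
Qed.

(** One successor and one predecessor determine the tube, so that a query reveals the path at no
    more than two vertices. *)
Lemma label_local l l' p :
  path_next l (decode p false) = path_next l' (decode p false) ->
  path_prev l (decode p true) = path_prev l' (decode p true) ->
  label l p =1 label l' p.
Proof.
move=> Hs Hp i.
have Ht : tube l p = tube l' p by rewrite /tube Hs Hp.
by rewrite /label /plane_field Ht.
Qed.

(* A family of points of a unit cell that avoids the end of the path always has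
   an axis on which its labels agree. *)
Section Cell.

Variables (l : path_system) (J : finType) (pt : J -> point) (base : point).
Hypothesis l_wf : path_system_wf l.
Hypothesis base_le : forall i, base i <= 18.
Hypothesis in_cell : forall a i, base i <= pt a i <= (base i).+1.
Hypothesis avoids_end :
  forall a s, decode (pt a) s != path_end l.

Definition escapes := exists i b, forall a, label l (pt a) i = b.

Lemma cell_dist a b i : pt a i <= (pt b i).+1.
Proof. by have := in_cell a i; have := in_cell b i; lia. Qed.

Lemma escapes_field (F : field) :
  consistent F (base (inr false)) (base (inr true)) ->
  (forall a, plane_field l (pt a) (rho (pt a)) (tau (pt a))
             = F (rho (pt a)) (tau (pt a))) ->
  escapes.
Proof.
set r := base (inr false); set t := base (inr true) => HF Hall.
have Hq a : (rho (pt a) = r \/ rho (pt a) = r.+1)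
         /\ (tau (pt a) = t \/ tau (pt a) = t.+1).
  by have := in_cell a (inr false); have := in_cell a (inr true); rewrite /rho /tau /r /t; lia.
case/orP: HF => /= /and4P [/eqP H1 /eqP H2 /eqP H3 _].
- exists (inr false), (F r t).1 => a /=; rewrite Hall.
  by case: (Hq a) => [[->|->] [->|->]].
- exists (inr true), (F r t).2 => a /=; rewrite Hall.
  by case: (Hq a) => [[->|->] [->|->]].
Qed.

Lemma same_side p q c d : p <= q.+1 -> q <= p.+1 -> c <= d.+1 -> d <= c.+1 ->
  (c + 2 < p) || (p + 2 < c) -> (q < d) = (p < c).
Proof. by lia. Qed.

(** Across a cell, points and centers each move by at most 1 per axis. A point more than 2 away from
    its center thus forces all points to the same side of their centers on that axis. *)
Lemma escapes_or_near (C : J -> vertex * vertex * vertex) :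
  (forall a, tube l (pt a) = Some (C a)) ->
  (forall a b s, center (C a) (progress (pt a)) s
              <= (center (C b) (progress (pt b)) s).+1) ->
  escapes \/ forall a, near (pt a) (C a).
Proof.
move=> HC Hdist.
case: (altP (@forallP _ (fun a => near (pt a) (C a)))) => [H|]; first by right.
rewrite negb_forall => /existsP [a]; rewrite negb_forall => /existsP [s].
rewrite negb_and -!ltnNge => Ha; left.
exists (inl s), (pt a (inl s) < center (C a) (progress (pt a)) s) => b /=.
rewrite HC; apply: same_side (Hdist _ _ _) (Hdist _ _ _) Ha; exact: cell_dist.
Qed.

(** Where the center sits at a bit position, 1 or 8, every point of the cell is at most 3 away from
    it, hence on the correct side of the threshold between 4 and 5. *)
Lemma decode_near a b c s (v : vertex) :
  near (pt a) c ->
  (forall j, center c (progress (pt a)) (s, j) = slide 0 (v j) (v j)) ->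
  decode (pt b) s = v.
Proof.
move=> /forallP Hn Hc; apply/ffunP => j; rewrite ffunE.
have := Hn (s, j); rewrite Hc /slide.
have := cell_dist a b (inl (s, j)); have := cell_dist b a (inl (s, j)).
by case: (v j) => /=; lia.
Qed.


Lemma slide_diag h b : h <= 7 -> slide h b b = slide 0 b b.
Proof. by rewrite /slide; case: b => /=; lia. Qed.

Lemma slide0 b b' : slide 0 b b' = slide 0 b b.
Proof. by rewrite /slide !muln0. Qed.

Lemma slide7 b b' : slide 7 b b' = slide 0 b' b'.
Proof. by rewrite /slide; case: b b' => [] []. Qed.

Lemma slide_step h h' b b' : h <= h'.+1 -> h' <= h.+1 ->
  slide h b b' <= (slide h' b b').+1.
Proof. by rewrite /slide; case: b b' => [] [] /=; lia. Qed.

Definition active a := if tube l (pt a) is Some c then near (pt a) c else false.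

Lemma activeP a : active a -> exists2 c, tube l (pt a) = Some c & near (pt a) c.
Proof. by rewrite /active; case: tube => // c; exists c. Qed.

Definition field_of (c : vertex * vertex * vertex) :=
  if c.1.1 == origin then start_field else tube_field.

Lemma plane_field_active a c : tube l (pt a) = Some c -> near (pt a) c ->
  plane_field l (pt a) = field_of c.
Proof. by rewrite /plane_field => -> ->. Qed.

Lemma plane_field_rest a : ~~ active a -> plane_field l (pt a) = rest_field.
Proof. by rewrite /active /plane_field; case: tube => // c /negbTE ->. Qed.

Lemma base_range : base (inr false) <= 18 /\ base (inr true) <= 18.
Proof. by split; apply: base_le. Qed.

Lemma rho_range a : base (inr false) <= rho (pt a) <= (base (inr false)).+1.
Proof. exact: in_cell. Qed.

Lemma tau_range a : base (inr true) <= tau (pt a) <= (base (inr true)).+1.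
Proof. exact: in_cell. Qed.

Lemma progress_step a b : progress (pt a) <= (progress (pt b)).+1.
Proof.
rewrite /progress; have := tau_range a; have := tau_range b; lia.
Qed.

Lemma eq_on_cellP (F G : field) a :
  eq_on_cell F G (base (inr false)) (base (inr true)) ->
  F (rho (pt a)) (tau (pt a)) = G (rho (pt a)) (tau (pt a)).
Proof.
case/and4P => /eqP H1 /eqP H2 /eqP H3 /eqP H4.
have := rho_range a; have := tau_range a.
set r := base (inr false) in H1 H2 H3 H4 *; set t := base (inr true) in H1 H2 H3 H4 * => Ht Hr.
have [Er|Er] : rho (pt a) = r \/ rho (pt a) = r.+1 by lia.
all: have [Et|Et] : tau (pt a) = t \/ tau (pt a) = t.+1 by lia.
all: by rewrite Er Et.
Qed.

(** Either a point is far from its center, and a spatial axis serves, or every point sees [F], and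
    an axis of the plane serves. *)
Lemma escapes_along (F : field) (C : J -> vertex * vertex * vertex) :
  (forall a, tube l (pt a) = Some (C a)) ->
  (forall a b s, center (C a) (progress (pt a)) s
              <= (center (C b) (progress (pt b)) s).+1) ->
  (forall a, field_of (C a) (rho (pt a)) (tau (pt a)) = F (rho (pt a)) (tau (pt a))) ->
  consistent F (base (inr false)) (base (inr true)) ->
  escapes.
Proof.
move=> HC Hdist HF Hcons.
have [//|Hnear] := escapes_or_near HC Hdist.
by apply: (escapes_field Hcons) => a; rewrite (plane_field_active (HC a)).
Qed.

Lemma escapes_one_tube c :
  (forall a, tube l (pt a) = Some c) ->
  consistent (field_of c) (base (inr false)) (base (inr true)) ->
  escapes.
Proof.
move=> Hc; apply: (@escapes_along _ (fun=> c)) => // a b s.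
by apply: slide_step; apply: progress_step.
Qed.

Lemma escapes_inactive :
  (base (inr false) == 5) && (base (inr true) == 5) = false ->
  (forall a, ~~ active a) -> escapes.
Proof.
move=> Hneq Hin; have [Hr Ht] := base_range.
apply: (@escapes_field rest_field); last by move=> a; rewrite plane_field_rest.
by have := rest_consistent Hr Ht; rewrite Hneq.
Qed.

(** As [rest_field] vanishes here, every point is given the tube at the origin, whose [start_field]
    has no zero in this cell. *)
Lemma escapes_hole : base (inr false) = 5 -> base (inr true) = 5 -> escapes.
Proof.
move=> Er Et; have [Hr Ht] := base_range.
apply: (@escapes_one_tube (origin, origin, origin)) => [a|].
  have := rho_range a; have := tau_range a; rewrite Er Et => H1 H2.
  by rewrite /tube /in_hole H1 H2.
have := start_consistent Hr Ht.
by rewrite /field_of eqxx Et andbF.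
Qed.

Lemma tube_outside a : ~~ in_hole (pt a) -> tube l (pt a) =
  if rho (pt a) < 6 then
    omap (fun w => (decode (pt a) false, decode (pt a) false, w))
      (path_next l (decode (pt a) false))
  else if decode (pt a) true == origin then Some (origin, origin, origin)
  else omap (fun u => (decode (pt a) true, u, decode (pt a) true))
      (path_prev l (decode (pt a) true)).
Proof. by rewrite /tube => /negbTE ->. Qed.

(** At progress 0 the tube entering [v] on the right half and the one leaving it on the left half
    are both centered at [(v, v)]. Since [v] is not the end of the path, neither is missing unless
    [v] is the origin, where the flow starts. *)
Lemma escapes_bottom : base (inr true) <= 6 -> escapes.
Proof.
move=> Ht6; have [Hr Ht] := base_range.
have [/andP [/eqP Er /eqP Et]|Hneq] :=
  boolP ((base (inr false) == 5) && (base (inr true) == 5)).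
  exact: escapes_hole.
have [a0 Ha0|Hno] := pickP active; last first.
  by apply: escapes_inactive (negbTE Hneq) _ => a; rewrite Hno.
have P0 a : progress (pt a) = 0.
  by rewrite /progress; have := tau_range a; lia.
have [c0 Hc0 Hn0] := activeP Ha0.
have dec_of a c b s : tube l (pt a) = Some c -> near (pt a) c -> decode (pt b) s = c.1.1.
  by move=> _ Hn; apply: decode_near Hn _ => j; rewrite P0 /center slide0.
have Hdec a s : decode (pt a) s = c0.1.1 by apply: dec_of Hc0 Hn0.
set v := c0.1.1 in Hdec.
have v_end : v != path_end l by rewrite -(Hdec a0 true) avoids_end.
have [wf1 wf2 /(_ _ v_end) wf3] := l_wf.
(* An active point shows that [v] lies on the path. *)
have succ_v : (v == origin) || isSome (path_next l v).
  move: Hc0; rewrite /tube; case: ifP => _; first by rewrite /v => -[<-]; rewrite eqxx.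
  rewrite !Hdec wf3; case: ifP => _.
    by have := wf3; case: (path_next l v) => //= w <-; rewrite orbT.
  by case: eqP => //= _; case: (path_prev l v).
have Htube a : ~~ in_hole (pt a) -> exists2 c, tube l (pt a) = Some c & c.1.1 = v.
  move/tube_outside ->; rewrite !Hdec; case: ifP => _.
    have : isSome (path_next l v) by case/orP: succ_v => // Hv; rewrite wf3 Hv.
    by case: (path_next l v) => //= w _; exists (v, v, w).
  case: eqP => [->|/eqP vn0]; first by exists (origin, origin, origin).
  move: succ_v; rewrite wf3 (negbTE vn0) /=.
  by case: (path_prev l v) => //= u _; exists (v, u, v).
have center_v c b s : c.1.1 = v -> center c (progress (pt b)) s = slide 0 (v s.2) (v s.2).
  by move=> Hc; rewrite P0 /center Hc slide0.
(* At the origin the points of the hole carry a tube with the same center, so [start_field] governs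
   the whole cell. *)
have [v0|vn0] := eqVneq v origin.
  have Htube' a : exists2 c, tube l (pt a) = Some c & c.1.1 = v.
    have [Hh|] := boolP (in_hole (pt a)); last exact: Htube.
    by exists (origin, origin, origin); rewrite /tube ?Hh.
  pose C a := odflt (origin, origin, origin) (tube l (pt a)).
  have HC a : tube l (pt a) = Some (C a) by rewrite /C; have [c ->] := Htube' a.
  have HCv a : (C a).1.1 = v by rewrite /C; have [c -> /=] := Htube' a.
  apply: (@escapes_along start_field C) => // [a b s|a|].
  - by rewrite !center_v.
  - by rewrite /field_of HCv v0 eqxx.
  - by have := start_consistent Hr Ht; rewrite ltnNge Ht6 andbF.
have Hcons : consistent tube_field (base (inr false)) (base (inr true)).
  by have := tube_consistent Hr Ht; rewrite (negbTE Hneq).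
(* Points of the hole carry the tube of the origin and are inactive here, but this close to the hole
   [tube_field] equals [rest_field]. *)
have [Htouch|Hfar] := boolP ((4 <= base (inr false) <= 6) && (4 <= base (inr true) <= 6)).
  apply: (escapes_field Hcons) => a.
  have := tube_rest_near_hole Hr Ht; rewrite Htouch /= => Heq.
  have [Hact|/plane_field_rest ->] := boolP (active a); last by rewrite (eq_on_cellP _ Heq).
  have [c Hc Hn] := activeP Hact.
  rewrite (plane_field_active Hc Hn) /field_of ifN //.
  by rewrite -(dec_of _ _ a true Hc Hn) Hdec.
have Hout a : ~~ in_hole (pt a).
  by move: Hfar; apply: contra; rewrite /in_hole; have := rho_range a; have := tau_range a; lia.
pose C a := odflt (origin, origin, origin) (tube l (pt a)).
have HC a : tube l (pt a) = Some (C a) by rewrite /C; have [c ->] := Htube a (Hout a).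
have HCv a : (C a).1.1 = v by rewrite /C; have [c -> /=] := Htube a (Hout a).
apply: (@escapes_along tube_field C) => // [a b s|a].
- by rewrite !center_v.
- by rewrite /field_of HCv (negbTE vn0).
Qed.

Lemma outside_hole a : 6 < base (inr true) -> ~~ in_hole (pt a).
Proof. by rewrite /in_hole; have := tau_range a; lia. Qed.

Lemma field_of_consistent c :
  base (inr false) != 5 ->
  consistent (field_of c) (base (inr false)) (base (inr true)).
Proof.
move=> Hr5; have [Hr Ht] := base_range; rewrite /field_of; case: ifP => _.
  by have := start_consistent Hr Ht; rewrite (negbTE Hr5).
by have := tube_consistent Hr Ht; rewrite (negbTE Hr5).
Qed.

(** On the left half [x] stays at [u] for every progress, so one active point fixes the tube of the
    whole cell. In [escapes_right], [y] stays at [w] in the same way. *)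
Lemma escapes_left : 6 < base (inr true) -> base (inr false) < 5 -> escapes.
Proof.
move=> Ht7 Hr5; have Hneq : base (inr false) != 5 by lia.
have [a0 Ha0|Hno] := pickP active; last first.
  by apply: escapes_inactive => [|a]; rewrite ?(negbTE Hneq) ?Hno.
have [c Hc Hn] := activeP Ha0.
have Hleft a : rho (pt a) < 6 by have := rho_range a; lia.
move: (Hc); rewrite tube_outside ?outside_hole // Hleft.
case Eu : (path_next l _) => [w|//] [Ec].
have Hdec a : decode (pt a) false = decode (pt a0) false.
  apply: decode_near Hn _ => j; rewrite -Ec /center /=.
  exact/slide_diag/progress_le.
apply: (@escapes_one_tube c); last exact: field_of_consistent.
by move=> a; rewrite tube_outside ?outside_hole // Hleft Hdec Eu -Ec.
Qed.

Lemma escapes_right : 6 < base (inr true) -> 5 < base (inr false) -> escapes.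
Proof.
move=> Ht7 Hr5; have Hneq : base (inr false) != 5 by lia.
have [a0 Ha0|Hno] := pickP active; last first.
  by apply: escapes_inactive => [|a]; rewrite ?(negbTE Hneq) ?Hno.
have [c Hc Hn] := activeP Ha0.
have Hright a : (rho (pt a) < 6) = false by have := rho_range a; lia.
have Hctr j : center c (progress (pt a0)) (true, j)
    = slide (progress (pt a0)) (decode (pt a0) true j) (decode (pt a0) true j).
  move: Hc; rewrite tube_outside ?outside_hole // Hright.
  case: eqP => [-> [<-] //|_]; case: (path_prev l _) => //= u [<-] //.
have Hdec a : decode (pt a) true = decode (pt a0) true.
  apply: decode_near Hn _ => j; rewrite Hctr.
  exact/slide_diag/progress_le.
apply: (@escapes_one_tube c); last exact: field_of_consistent.
move=> a; rewrite -Hc !tube_outside ?outside_hole // !Hright.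
by rewrite Hdec.
Qed.

Lemma escapes_middle :
  base (inr false) = 5 -> 6 < base (inr true) < 14 -> escapes.
Proof.
move=> Er Et; have [Hr Ht] := base_range.
have := fields_above_hole Hr Ht; rewrite Er Et /= => /andP [Htube Hstart].
apply: (@escapes_field rest_field) => [|a].
  by have := rest_consistent Hr Ht; rewrite (_ : (base (inr true) == 5) = false) ?andbF //; lia.
rewrite -Er in Htube Hstart.
rewrite /plane_field; case: tube => // c; case: ifP => // _; case: ifP => _.
  exact: eq_on_cellP Hstart.
exact: eq_on_cellP Htube.
Qed.

(** At progress 7 both halves of the tube of an edge [u -> w] are centered at [(u, w)], and
    [path_next] and [path_prev] being inverse makes them belong to the same edge. *)
Lemma escapes_top : base (inr false) = 5 -> 13 < base (inr true) -> escapes.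
Proof.
move=> Er Et; have [Hr Ht] := base_range; have [wf1 wf2 _] := l_wf.
have Ht7 : 6 < base (inr true) by lia.
have Hq a : 6 < tau (pt a) by have := tau_range a; lia.
have P7 a : progress (pt a) = 7 by rewrite /progress; have := tau_range a; lia.
(* The active points left out have [y] at the origin on the right half, where [start_field] is
   [rest_field]; they behave like inactive ones. *)
have [a0 /andP [Ha0 Hreal]|Hno] := pickP (fun a =>
    active a && ((rho (pt a) < 6) || (decode (pt a) true != origin))); last first.
  apply: (@escapes_field rest_field) => [|a].
    by have := rest_consistent Hr Ht; rewrite (_ : (base (inr true) == 5) = false) ?andbF //; lia.
  have [Ha|/plane_field_rest -> //] := boolP (active a).
  have := Hno a; rewrite Ha /= => /norP [Hrho /negPn Hw].
  have [c Hc Hn] := activeP Ha.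
  move: (Hc); rewrite tube_outside ?outside_hole // (negbTE Hrho) Hw => -[Ec].
  by rewrite (plane_field_active Hc Hn) -Ec /field_of eqxx /start_field Hq (negbTE Hrho).
have [c Hc Hn] := activeP Ha0.
have [u [w [Euw Ec]]] : exists u w, path_next l u = Some w /\ c.1.2 = u /\ c.2 = w.
  move: Hc; rewrite tube_outside ?outside_hole //.
  case: ifP Hreal => /= [_ _|_ /negbTE ->].
    by case E: (path_next l _) => [w|//] [<-]; exists (decode (pt a0) false), w.
  case E: (path_prev l _) => [u|//] [<-]; exists u, (decode (pt a0) true).
  by split=> //; apply/wf1.
have Hdec s a : decode (pt a) s = if s then w else u.
  apply: decode_near Hn _ => j; rewrite P7 /center slide7 /=.
  by case: Ec => -> ->; case: s.
have w_neq : w != origin.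
  by apply/eqP => w0; move: Euw; rewrite w0 => /wf1; rewrite wf2.
pose C a := if rho (pt a) < 6 then (u, u, w) else (w, u, w).
apply: (@escapes_along tube_field C) => [a|a b s|a|].
- rewrite tube_outside ?outside_hole // !Hdec Euw (negbTE w_neq).
  by have /wf1 -> := Euw; rewrite /C; case: ifP.
- rewrite !P7 /center /C !slide7.
  by case: (rho (pt a) < 6); case: (rho (pt b) < 6) => /=; rewrite leqnSn.
(* On the left half [start_field] is [tube_field] at this height, which covers [u] being the
   origin. *)
- rewrite /C /field_of; case: (ltnP (rho (pt a)) 6) => Hrho /=; last by rewrite (negbTE w_neq).
  by case: ifP => // _; rewrite /start_field Hq Hrho.
- by have := tube_consistent Hr Ht; rewrite (_ : (base (inr true) == 5) = false) ?andbF //; lia.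
Qed.

Lemma cell_escapes : escapes.
Proof.
have [Ht6|Ht7] := leqP (base (inr true)) 6; first exact: escapes_bottom.
case: (ltngtP (base (inr false)) 5) => Hr5.
- exact: escapes_left.
- exact: escapes_right.
- have [Ht14|Ht14] := ltnP (base (inr true)) 14; last exact: escapes_top.
  by apply: escapes_middle; rewrite ?Ht7.
Qed.

End Cell.

End Labels.

(** * The adversary that lengthens the path *)

Section Adversary.

Variable k : nat.
Let vertex := {ffun 'I_k -> bool}.

Definition touched (p : axis k -> nat) : {set vertex} :=
  [set decode p false; decode p true].

Definition agree_on (S : {set vertex}) (l l' : path_system k) :=
  {in S, path_next l =1 path_next l'} /\ {in S, path_prev l =1 path_prev l'}.

(* [S] consists of the vertices that the answers given so far may depend on. *)
Definition known_path (S : {set vertex}) (l : path_system k) :=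
  [/\ path_system_wf l, path_end l \notin S, path_next l (path_end l) = None,
      (path_end l == origin k) || isSome (path_prev l (path_end l)) &
      forall v, v \notin S -> v != path_end l ->
        [/\ v != origin k, path_next l v = None & path_prev l v = None]].

Lemma agree_onS (S S' : {set vertex}) l l' : S \subset S' -> agree_on S' l l' -> agree_on S l l'.
Proof. by move=> /subsetP HS [Hs Hp]; split=> v /HS; [apply: Hs | apply: Hp]. Qed.

Lemma agree_on_trans S l1 l2 l3 : agree_on S l1 l2 -> agree_on S l2 l3 -> agree_on S l1 l3.
Proof.
by move=> [s12 p12] [s23 p23]; split=> v vS; [rewrite s12 ?s23 | rewrite p12 ?p23].
Qed.

Lemma label_agree l l' p : agree_on (touched p) l l' -> label l p =1 label l' p.
Proof.
move=> [Hs Hp]; apply: label_local.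
- by apply: Hs; rewrite !inE eqxx.
- by apply: Hp; rewrite !inE eqxx orbT.
Qed.

Definition empty_path : path_system k :=
  PathSystem (fun=> None) (fun=> None) (origin k).

Lemma empty_path_known : known_path set0 empty_path.
Proof.
split; rewrite ?inE ?eqxx //=; by split=> //= u /negbTE ->.
Qed.

Definition extend (l : path_system k) (w : vertex) : path_system k :=
  PathSystem (fun u => if u == path_end l then Some w else path_next l u)
    (fun v => if v == w then Some (path_end l) else path_prev l v) w.

(** Only the successor of the old end and the predecessor of [w] change, and both vertices lie
    outside [S]. *)
Lemma extend_known S l w :
  known_path S l -> w \notin path_end l |: S ->
  known_path (path_end l |: S) (extend l w) /\ agree_on S l (extend l w).
Proof.
case=> [[wf1 wf2 wf3] Hend send pend Hfresh]; rewrite !inE negb_or => /andP [Hwe HwS].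
have [w0 sw pw] := Hfresh w HwS Hwe.
split; last first.
  split=> v vS /=; case: eqP vS => // ->; first by rewrite (negbTE Hend).
  by rewrite (negbTE HwS).
split=> /=; last 4 first.
- by rewrite !inE negb_or Hwe.
- by rewrite (negbTE Hwe).
- by rewrite eqxx orbT.
- move=> v; rewrite !inE negb_or => /andP [Hve HvS] Hvw.
  by rewrite (negbTE Hve) (negbTE Hvw); apply: Hfresh.
split=> /= [u v||u Hu].
- have [->|Hue] := eqVneq u (path_end l); have [->|Hvw] := eqVneq v w.
  + by split.
  + split=> [[/esym/eqP]|/wf1]; first by rewrite (negbTE Hvw).
    by rewrite send.
  + split=> [/wf1|[/esym/eqP]]; first by rewrite pw.
    by rewrite (negbTE Hue).
  + exact: wf1.
- by rewrite eq_sym (negbTE w0).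
- rewrite (negbTE Hu); have [->|Hue] := eqVneq u (path_end l); last exact: wf3.
  by rewrite pend.
Qed.

Lemma fresh_vertex (S : {set vertex}) : #|S| < 2 ^ k -> exists w, w \notin S.
Proof.
move=> HS; apply/existsP; apply: contraLR HS; rewrite negb_exists => /forallP HS.
have -> : S = setT by apply/setP => w; rewrite inE; have := HS w; rewrite negbK.
by rewrite -leqNgt cardsT card_ffun card_bool card_ord.
Qed.

(** The two touched vertices join the set; if the end is one of them, the path first moves on to a
    fresh vertex. *)
Lemma answer_point S l p : known_path S l -> #|S| + 2 < 2 ^ k ->
  exists l' (S' : {set vertex}), [/\ known_path S' l', S :|: touched p \subset S',
    agree_on S l l' & #|S'| <= #|S| + 2].
Proof.
move=> Hl HS; have touched2 : #|touched p| <= 2 by rewrite cards2; case: (_ != _).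
have [He|He] := boolP (path_end l \in touched p); last first.
  have [wf Hend send pend Hfresh] := Hl.
  exists l, (S :|: touched p); split=> //.
    split=> //; first by rewrite inE negb_or Hend.
    by move=> v; rewrite inE negb_or => /andP [/Hfresh].
  by apply: leq_trans (leq_card_setU _ _) _; rewrite leq_add2l.
(* The end is left out because [known_path] wants it outside the set; [extend_known] then adds
   it. *)
pose S1 := S :|: (touched p :\ path_end l).
have HS1 : #|path_end l |: S1| <= #|S| + 2.
  rewrite /S1 setUCA setD1K //.
  by apply: leq_trans (leq_card_setU _ _) _; rewrite leq_add2l.
have [w Hw] := fresh_vertex (leq_ltn_trans HS1 HS).
have Hl1 : known_path S1 l.
  have [wf Hend send pend Hfresh] := Hl.
  split=> //; first by rewrite !inE eqxx negb_or Hend.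
  by move=> v; rewrite inE negb_or => /andP [/Hfresh].
have [Hl' Hagree] := extend_known Hl1 Hw.
exists (extend l w), (path_end l |: S1); split=> //.
  by rewrite /S1 [_ |: _]setUCA setD1K.
by apply: agree_onS Hagree; apply: subsetUl.
Qed.

(** This serves after the run, to move the end of the path away from all samples of the output. *)
Lemma answer_points ps S l : known_path S l -> #|S| + 2 * size ps < 2 ^ k ->
  exists l' (S' : {set vertex}), [/\ known_path S' l', S \subset S', agree_on S l l' &
    forall i, i < size ps -> touched (nth (fun=> 0) ps i) \subset S'].
Proof.
elim: ps S l => [|p ps IH] S l Hl /= HS; first by exists l, S; split.
have [|l1 [S1 [Hl1 HS1 Ha1 Hc1]]] := answer_point p Hl.
  by move: HS; move: #|S| (2 ^ k) => c N; lia.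
have [|l2 [S2 [Hl2 HS2 Ha2 Hps]]] := IH _ _ Hl1.
  by move: HS Hc1; move: #|S| #|S1| (2 ^ k) => c c1 N; lia.
move: HS1; rewrite subUset => /andP [HS1 Hp].
exists l2, S2; split=> //; first exact: subset_trans HS2.
  exact/(agree_on_trans Ha1)/agree_onS/Ha2.
by case=> [|i] Hi /=; [apply: subset_trans HS2 | apply: Hps].
Qed.

Variables (X Y : Type) (point_of : X -> axis k -> nat) (oracle_of : path_system k -> X -> bool).
Hypothesis oracle_local : forall l l' x,
  agree_on (touched (point_of x)) l l' -> oracle_of l x = oracle_of l' x.

(** All answers given depend only on the path at [S'], so a run with fewer than [n] queries has a
    fixed output while the path can still be extended. *)
Lemma answer_queries (t : query_tree X Y) n S l :
  known_path S l -> #|S| + 2 * n < 2 ^ k ->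
  exists l' (S' : {set vertex}), [/\ known_path S' l', S \subset S', agree_on S l l',
    #|S'| <= #|S| + 2 * n &
    n <= num_queries t (oracle_of l') \/
    forall l'', agree_on S' l' l'' -> run t (oracle_of l'') = run t (oracle_of l')].
Proof.
elim: t n S l => [y|x t IH] n S l Hl HS.
  by exists l, S; split=> //=; [exact: leq_addr | right].
case: n HS => [|n] HS; first by exists l, S; split=> //; [exact: leq_addr | left].
have [|l1 [S1 [Hl1 HS1 Ha1 Hc1]]] := answer_point (point_of x) Hl.
  by move: HS; move: #|S| (2 ^ k) => c N; lia.
have [|l2 [S2 [Hl2 HS2 Ha2 Hc2 Hrun]]] := IH (oracle_of l1 x) n _ _ Hl1.
  by move: HS Hc1; move: #|S| #|S1| (2 ^ k) => c c1 N; lia.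
move: HS1; rewrite subUset => /andP [HS1 Hx].
have Hx2 l'' : agree_on S1 l1 l'' -> oracle_of l'' x = oracle_of l1 x.
  by move=> H; apply/esym/oracle_local/agree_onS/H.
exists l2, S2; split=> //=; first exact: subset_trans HS2.
- exact/(agree_on_trans Ha1)/agree_onS/Ha2.
- by move: Hc1 Hc2; move: #|S| #|S1| #|S2| => c c1 c2; lia.
rewrite Hx2 //; case: Hrun => Hrun; [by left | right=> l'' Hl''].
by rewrite Hx2 ?Hrun //; apply/(agree_on_trans Ha2)/agree_onS/Hl''.
Qed.

End Adversary.

(** * Circuits whose nodes are the outputs of their gates *)

Section Netlist.

Lemma card_image_one (A G : finType) (f : A -> G) (Q : pred G) a0 :
  (forall a, Q (f a) = (a == a0)) -> #|[set g in [set f a | a : A] | Q g]| = 1.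
Proof.
move=> HQ; rewrite -(cards1 (f a0)); apply: eq_card => g; rewrite !inE.
apply/andP/eqP => [[/imsetP [a _ ->]]|->]; first by rewrite HQ => /eqP ->.
by rewrite imset_f // HQ eqxx.
Qed.

Lemma card_image_none (A G : finType) (f : A -> G) (Q : pred G) :
  (forall a, Q (f a) = false) -> #|[set g in [set f a | a : A] | Q g]| = 0.
Proof.
move=> HQ; apply: eq_card0 => g; rewrite !inE.
by apply/andP => -[/imsetP [a _ ->]]; rewrite HQ.
Qed.

Variables (N P O : finType) (ar : nat).

Definition wire := (N + P * bool + O)%type.
Definition nor_out (g : N) : wire := inl (inl g).
Definition purify_out (g : P) (b : bool) : wire := inl (inr (g, b)).
Definition oracle_out (g : O) : wire := inr g.

Variables (nor_in : N -> wire * wire) (purify_in : P -> wire)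
  (oracle_in : O -> ar.-tuple wire) (o0 : O).
Hypothesis nor_uniq : forall g, uniq [:: (nor_in g).1; (nor_in g).2; nor_out g].
Hypothesis purify_uniq : forall g b, purify_in g != purify_out g b.
Hypothesis oracle_uniq : forall g, uniq (rcons (oracle_in g) (oracle_out g)).

Let nor_set : {set wire * wire * wire} :=
  [set (nor_in g, nor_out g) | g : N].
Let purify_set : {set wire * wire * wire} :=
  [set ((purify_in g, purify_out g false), purify_out g true) | g : P].
Let oracle_set : {set ar.-tuple wire * wire} :=
  [set (oracle_in g, oracle_out g) | g : O].

(** The inputs of the single gate [o0] are already [ar] distinct nodes. *)
Lemma netlist_arity_le : ar <= #|{: wire}|.
Proof.
have := oracle_uniq o0; rewrite rcons_uniq => /andP [_ /card_uniqP H].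
by rewrite -[X in X <= _](size_tuple (oracle_in o0)) -H max_card.
Qed.

Lemma netlist_nor_distinct u v w : (u, v, w) \in nor_set -> uniq [:: u; v; w].
Proof. by case/imsetP => g _ [E ->]; have := nor_uniq g; rewrite -E. Qed.

Lemma netlist_purify_distinct u v w : (u, v, w) \in purify_set -> uniq [:: u; v; w].
Proof.
case/imsetP => g _ [-> -> ->] /=.
by rewrite !inE negb_or !purify_uniq /= andbT; apply/eqP => -[].
Qed.

Lemma netlist_oracle_distinct (us : ar.-tuple wire) v :
  (us, v) \in oracle_set -> uniq (rcons us v).
Proof. by case/imsetP => g _ [-> ->]. Qed.

Lemma netlist_output_unique (x : wire) :
    #|[set g in nor_set | g.2 == x]|
    + #|[set g in purify_set | (g.1.2 == x) || (g.2 == x)]|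
    + #|[set g in oracle_set | g.2 == x]| = 1.
Proof.
case: x => [[n|[p b]]|o].
- by rewrite (card_image_one (a0 := n)) // !card_image_none.
- rewrite card_image_none // (card_image_one (a0 := p)) ?card_image_none // => g.
  by case: b; rewrite /= /purify_out !(inj_eq inl_inj) !(inj_eq inr_inj) !xpair_eqE /= ?andbT ?andbF ?orbF.
- by rewrite (card_image_one (a0 := o)) // !card_image_none.
Qed.

Definition netlist : circuit :=
  Circuit netlist_arity_le netlist_nor_distinct netlist_purify_distinct
    netlist_oracle_distinct netlist_output_unique.

Lemma netlist_solution (L : oracle netlist) (b : assignment netlist) :
  is_solution L b ->
  [/\ forall g, nor_ok b (nor_in g).1 (nor_in g).2 (nor_out g),
      forall g, purify_ok b (purify_in g) (purify_out g false) (purify_out g true) &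
      forall g, oracle_ok L b (oracle_in g) (oracle_out g)].
Proof.
case=> Hn Hp Ho; split=> g.
- by apply: Hn; rewrite -surjective_pairing; apply/imsetP; exists g.
- by apply: Hp; apply/imsetP; exists g.
- by apply: Ho; apply/imsetP; exists g.
Qed.

End Netlist.

(** * The gates of the hard circuit *)

Section Gates.

Variables (I : finType) (M pad : nat).
Local Notation sample := 'I_(2 * #|I|).+1.
Local Notation level := 'I_#|I|.+1.

(** [Pad] gates adjust the number of nodes to any prescribed large value. *)
Inductive nor_gate :=
| Neg of bool
| Contra of bool & bool
| Valid of bool
| Zero
| One of I
| NegSample of I & sample
| CellAnd of I & sample & level
| CellNor of I & sample & level
| CellOr of I & sample & level
| Pad of 'I_pad.

(** Inputs of a gate have to be distinct, so [Half] duplicates a bit before a NOR gate negates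
    it. *)
Inductive purify_gate :=
| Split
| Half of bool
| ZeroCopy of I
| Unary of I & 'I_M
| Sample of I & 'I_M & sample.

Definition nor_code := (bool + bool * bool + bool + unit + I + I * sample
  + I * sample * level + I * sample * level + I * sample * level + 'I_pad)%type.

Definition nor_encode (g : nor_gate) : nor_code :=
  match g with
  | Neg b => inl (inl (inl (inl (inl (inl (inl (inl (inl b))))))))
  | Contra b c => inl (inl (inl (inl (inl (inl (inl (inl (inr (b, c)))))))))
  | Valid b => inl (inl (inl (inl (inl (inl (inl (inr b)))))))
  | Zero => inl (inl (inl (inl (inl (inl (inr tt))))))
  | One i => inl (inl (inl (inl (inl (inr i)))))
  | NegSample i a => inl (inl (inl (inl (inr (i, a)))))
  | CellAnd i a h => inl (inl (inl (inr (i, a, h))))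
  | CellNor i a h => inl (inl (inr (i, a, h)))
  | CellOr i a h => inl (inr (i, a, h))
  | Pad j => inr j
  end.

Definition nor_decode (c : nor_code) : nor_gate :=
  match c with
  | inl (inl (inl (inl (inl (inl (inl (inl (inl b)))))))) => Neg b
  | inl (inl (inl (inl (inl (inl (inl (inl (inr (b, c))))))))) => Contra b c
  | inl (inl (inl (inl (inl (inl (inl (inr b))))))) => Valid b
  | inl (inl (inl (inl (inl (inl (inr tt)))))) => Zero
  | inl (inl (inl (inl (inl (inr i))))) => One i
  | inl (inl (inl (inl (inr (i, a))))) => NegSample i a
  | inl (inl (inl (inr (i, a, h)))) => CellAnd i a h
  | inl (inl (inr (i, a, h))) => CellNor i a h
  | inl (inr (i, a, h)) => CellOr i a h
  | inr j => Pad j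
  end.

Lemma nor_encodeK : cancel nor_encode nor_decode.
Proof. by case. Qed.

Lemma nor_decodeK : cancel nor_decode nor_encode.
Proof. by repeat case=> //. Qed.

HB.instance Definition _ := Finite.copy nor_gate (can_type nor_encodeK).

Definition purify_code := (unit + bool + I + I * 'I_M + I * 'I_M * sample)%type.

Definition purify_encode (g : purify_gate) : purify_code :=
  match g with
  | Split => inl (inl (inl (inl tt)))
  | Half b => inl (inl (inl (inr b)))
  | ZeroCopy i => inl (inl (inr i))
  | Unary i t => inl (inr (i, t))
  | Sample i t a => inr (i, t, a)
  end.

Definition purify_decode (c : purify_code) : purify_gate :=
  match c with
  | inl (inl (inl (inl tt))) => Split
  | inl (inl (inl (inr b))) => Half b
  | inl (inl (inr i)) => ZeroCopy i
  | inl (inr (i, t)) => Unary i t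
  | inr (i, t, a) => Sample i t a
  end.

Lemma purify_encodeK : cancel purify_encode purify_decode.
Proof. by case. Qed.

Lemma purify_decodeK : cancel purify_decode purify_encode.
Proof. by repeat case=> //. Qed.

HB.instance Definition _ := Finite.copy purify_gate (can_type purify_encodeK).

Lemma card_nor_gate : #|{: nor_gate}| =
  let K := #|I| in let s := (2 * K).+1 in
  9 + pad + K + K * s + 3 * (K * s * K.+1).
Proof.
rewrite (bij_eq_card (Bijective nor_encodeK nor_decodeK)).
rewrite !card_sum !card_prod !card_bool card_unit !card_ord /=; lia.
Qed.

Lemma card_purify_gate : #|{: purify_gate}| =
  let K := #|I| in 3 + K + K * M + K * M * (2 * K).+1.
Proof.
rewrite (bij_eq_card (Bijective purify_encodeK purify_decodeK)).
by rewrite !card_sum !card_prod !card_bool card_unit !card_ord /=; lia.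
Qed.

Definition oracle_gate := (I * sample)%type.
Definition gate_wire := wire nor_gate purify_gate oracle_gate.

Definition nor_wire (g : nor_gate) : gate_wire := nor_out _ _ g.
Definition purify_wire (g : purify_gate) (b : bool) : gate_wire := purify_out _ _ g b.
Definition oracle_wire (i : I) (a : sample) : gate_wire := oracle_out _ _ (i, a).

Definition ord_prev n (a : 'I_n) : 'I_n :=
  Ordinal (leq_ltn_trans (leq_pred a) (ltn_ord a)).

(* The constant 0: one of the two outputs of [Split] is pure, and for a pure bit
   x both [Contra] gates compute NOR(x, NOT x) = 0, so that [Valid] is 1.  The
   cells implement t(a,h) = t(a-1,h) OR (sample a AND t(a-1,h-1)), where t(a,h)
   says that at least h of the first a samples are 1; the indices [a] and [h]
   of a cell are shifted by one, and [CellNor] is the negation of [CellOr]. *)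
Definition gate_nor_in (g : nor_gate) : gate_wire * gate_wire :=
  match g with
  | Neg b => (purify_wire (Half b) false, purify_wire (Half b) true)
  | Contra b c => (purify_wire (Half b) c, nor_wire (Neg b))
  | Valid b => (nor_wire (Contra b false), nor_wire (Contra b true))
  | Zero => (nor_wire (Valid false), nor_wire (Valid true))
  | One i => (nor_wire Zero, purify_wire (ZeroCopy i) false)
  | NegSample i a => (oracle_wire i a, nor_wire Zero)
  | CellAnd i a h => (nor_wire (NegSample i a),
      if (h : nat) == 0 then nor_wire Zero
      else if (a : nat) == 0 then nor_wire (One i)
      else nor_wire (CellNor i (ord_prev a) (ord_prev h)))
  | CellNor i a h => (nor_wire (CellAnd i a h),
      if (a : nat) == 0 then nor_wire Zero else nor_wire (CellOr i (ord_prev a) h))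
  | CellOr i a h => (nor_wire (CellNor i a h), nor_wire Zero)
  | Pad _ => (nor_wire (Neg false), nor_wire (Neg true))
  end.

Definition out_wire (i : I) : gate_wire := nor_wire (CellOr i ord_max ord_max).

Definition gate_purify_in (g : purify_gate) : gate_wire :=
  match g with
  | Split => nor_wire Zero
  | Half b => purify_wire Split b
  | ZeroCopy _ => nor_wire Zero
  | Unary i t => if (t : nat) == 0 then out_wire i else purify_wire (Unary i (ord_prev t)) true
  | Sample i t a => if (a : nat) == 0 then purify_wire (Unary i t) false
      else purify_wire (Sample i t (ord_prev a)) true
  end.

(* A query consists of the unary bits of a point and of the one-hot encoding of
   the coordinate whose label is asked for. *)
Definition query_slot := (I * 'I_M + I)%type.

(** Each axis has constant nodes of its own, which keeps the inputs of an oracle gate distinct. *)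
Definition slot_wire (i : I) (a : sample) (w : query_slot) : gate_wire :=
  match w with
  | inl (j, t) => purify_wire (Sample j t a) false
  | inr j => if j == i then nor_wire (One j) else purify_wire (ZeroCopy j) false
  end.

Definition gate_oracle_in (g : oracle_gate) : #|{: query_slot}|.-tuple gate_wire :=
  [tuple slot_wire g.1 g.2 (enum_val j) | j < #|{: query_slot}|].

Lemma ord_prev_neq n (a : 'I_n) : (a : nat) != 0 -> ord_prev a <> a.
Proof. by case: a => -[|a] Ha //= _ /(congr1 val) /=; lia. Qed.

Lemma gate_nor_uniq g :
  uniq [:: (gate_nor_in g).1; (gate_nor_in g).2; nor_out _ _ g].
Proof.
rewrite /= !inE negb_or andbT -andbA; apply/and3P.
by case: g => *; split; apply/eqP => //=; do ?case: ifP => _; case.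
Qed.

Lemma gate_purify_uniq g b : gate_purify_in g != purify_out _ _ g b.
Proof.
apply/eqP; case: g => [|c|i|i t|i t a] //=; case: ifP => // /negbT H [].
all: by move=> /(ord_prev_neq H).
Qed.

Lemma slot_wire_inj i a : injective (slot_wire i a).
Proof.
move=> [[j t]|j] [[j' t']|j'] /=; do ?case: ifP => _; try by [].
- by case=> -> ->.
- by case=> ->.
- by case=> ->.
Qed.

Lemma gate_oracle_uniq g : uniq (rcons (gate_oracle_in g) (oracle_out _ _ g)).
Proof.
rewrite rcons_uniq; apply/andP; split.
  apply/mapP => -[j _]; rewrite /slot_wire.
  by case: (enum_val j) => [[j' t]|j'] //; case: ifP.
rewrite map_inj_in_uniq ?enum_uniq // => j j' _ _ /slot_wire_inj.
exact: enum_val_inj.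
Qed.

Variable i0 : I.

Definition gate_circuit : circuit :=
  netlist (i0, ord0) gate_nor_uniq gate_purify_uniq gate_oracle_uniq.

Lemma card_gate_circuit : #|node gate_circuit| =
  pad + (let K := #|I| in let s := (2 * K).+1 in
   9 + K + K * s + 3 * (K * s * K.+1) + 2 * (3 + K + K * M + K * M * s) + K * s).
Proof.
rewrite [LHS]card_sum card_sum !card_prod card_nor_gate card_purify_gate card_bool !card_ord /=; lia.
Qed.

End Gates.

Arguments Neg {I pad}.
Arguments Contra {I pad}.
Arguments Valid {I pad}.
Arguments Zero {I pad}.
Arguments One {I pad}.
Arguments NegSample {I pad}.
Arguments CellAnd {I pad}.
Arguments CellNor {I pad}.
Arguments CellOr {I pad}.
Arguments Split {I M}.
Arguments Half {I M}.
Arguments ZeroCopy {I M}.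
Arguments Unary {I M}.
Arguments Sample {I M}.
Arguments nor_wire {I M pad}.
Arguments purify_wire {I M pad}.
Arguments oracle_wire {I M pad}.
Arguments out_wire {I M pad}.
Arguments gate_nor_in {I M pad}.
Arguments gate_purify_in {I M pad}.

(** * Properties of a solution of the circuit *)

Section Solution.

Variables (I : finType) (M pad : nat) (i0 : I).
Local Notation sample := 'I_(2 * #|I|).+1.
Local Notation level := 'I_#|I|.+1.
Local Notation circ := (gate_circuit M pad i0).

Definition slot_bit (x : (arity circ).-tuple bool) (w : query_slot I M) : bool :=
  tnth x (enum_rank w).

Definition query_point (x : (arity circ).-tuple bool) (i : I) : nat :=
  \sum_(t < M) slot_bit x (inl (i, t)).

Definition label_oracle (f : (I -> nat) -> I -> bool) : oracle circ := fun x =>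
  if [pick i | slot_bit x (inr i)] is Some i then f (query_point x) i else false.

Definition sample_point (b : assignment circ) (a : sample) (i : I) : nat :=
  \sum_(t < M) (b (purify_wire (Sample i t a) false) == Some true).

Definition pure_sample (b : assignment circ) : {set sample} :=
  [set a | [forall i, forall t, b (purify_wire (Sample i t a) false) != None]].

Variables (f : (I -> nat) -> I -> bool) (b : assignment circ).
Hypothesis f_border : forall p i, (forall i, p i <= M) ->
  (p i = 0 -> f p i) /\ (p i = M -> ~~ f p i).
Hypothesis b_solution : is_solution (label_oracle f) b.

Lemma nor_false g :
  b (gate_nor_in g).1 = Some true \/ b (gate_nor_in g).2 = Some true ->
  b (nor_wire g) = Some false.
Proof. by have [H _ _] := netlist_solution b_solution; exact: (H g).2. Qed.

Lemma nor_true g :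
  b (gate_nor_in g).1 = Some false -> b (gate_nor_in g).2 = Some false ->
  b (nor_wire g) = Some true.
Proof. by have [H _ _] := netlist_solution b_solution => H1 H2; apply: (H g).1. Qed.

Lemma purify_copy g x c : b (gate_purify_in g) = Some x -> b (purify_wire g c) = Some x.
Proof.
have [_ H _] := netlist_solution b_solution => Hx.
by have [_ /(_ x Hx) [H0 H1]] := H g; case: c.
Qed.

Lemma purify_one_pure g : b (purify_wire g false) = None ->
  exists x, b (purify_wire g true) = Some x.
Proof.
have [_ H _] := netlist_solution b_solution => Hx.
have [[/(_ Hx)//|Ht] _] := H g.
by case E: (b (purify_wire g true)) Ht => [x|//] _; exists x.
Qed.

Lemma zero_false : b (nor_wire Zero) = Some false.
Proof.
have valid c x : b (purify_wire Split c) = Some x -> b (nor_wire (Valid c)) = Some true.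
  move=> Hx; have Hhalf d : b (purify_wire (Half c) d) = Some x by apply: purify_copy.
  have Hneg : b (nor_wire (Neg c)) = Some (~~ x).
    by case: x {Hx} Hhalf => Hhalf; [apply: nor_false; left | apply: nor_true]; apply: Hhalf.
  have Hcontra d : b (nor_wire (Contra c d)) = Some false.
    apply: nor_false; rewrite /= Hneg Hhalf.
    by case: x {Hx Hhalf Hneg}; [left | right].
  by apply: nor_true; apply: Hcontra.
apply: nor_false; case E: (b (purify_wire Split false)) => [x|].
  by left; apply: valid E.
by have [x /valid] := purify_one_pure E; right.
Qed.

Lemma zero_copy_false i : b (purify_wire (ZeroCopy i) false) = Some false.
Proof. by apply: purify_copy; apply: zero_false. Qed.

Lemma one_true i : b (nor_wire (One i)) = Some true.
Proof. by apply: nor_true; [exact: zero_false | exact: zero_copy_false]. Qed.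

(* Once a chain of PURIFY gates meets a pure value, it copies it to all later
   outputs; so a chain has at most one impure output. *)
Lemma purify_chain n (x : option bool) (g : 'I_n -> purify_gate I M) :
  (forall a, b (gate_purify_in (g a)) =
     if (a : nat) == 0 then x else b (purify_wire (g (ord_prev a)) true)) ->
  (forall v, x = Some v -> forall a c, b (purify_wire (g a) c) = Some v) /\
  (forall a a', b (purify_wire (g a) false) = None ->
     b (purify_wire (g a') false) = None -> a = a').
Proof.
move=> Hg.
have later a v : b (purify_wire (g a) true) = Some v -> forall m (a' : 'I_n), (a' : nat) = m ->
    a < a' -> forall c, b (purify_wire (g a') c) = Some v.
  move=> Ha; elim=> [|m IH] a' Em lt_aa' c; first by rewrite Em in lt_aa'.
  apply: purify_copy; rewrite Hg Em /=.
  move: lt_aa'; rewrite Em ltnS leq_eqVlt => /orP [/eqP Eam|lt_am].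
    by rewrite (_ : ord_prev a' = a) //; apply: val_inj; rewrite /= Em.
  by apply: IH; rewrite /= Em.
split=> [v Hx|].
  suff H m (a : 'I_n) : (a : nat) = m -> forall c, b (purify_wire (g a) c) = Some v.
    by move=> a c; apply: H.
  elim: m a => [|m IH] a Em c; apply: purify_copy; rewrite Hg Em //=.
  by apply: IH; rewrite /= Em.
have no_lt (a a' : 'I_n) : b (purify_wire (g a) false) = None ->
    b (purify_wire (g a') false) = None -> ~ a < a'.
  by move=> /purify_one_pure [v /later Hv] Ha' /(Hv _ a' erefl) /(_ false); rewrite Ha'.
move=> a a' Ha Ha'.
by case: (ltngtP a a') => [/(no_lt _ _ Ha Ha')|/(no_lt _ _ Ha' Ha)|/ord_inj].
Qed.

Lemma unary_chain i :
  (forall v, b (out_wire i) = Some v -> forall t c, b (purify_wire (Unary i t) c) = Some v) /\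
  (forall t t', b (purify_wire (Unary i t) false) = None ->
     b (purify_wire (Unary i t') false) = None -> t = t').
Proof. by apply: purify_chain => t /=; case: ifP. Qed.

Lemma sample_chain i t :
  (forall v, b (purify_wire (Unary i t) false) = Some v ->
     forall a c, b (purify_wire (Sample i t a) c) = Some v) /\
  (forall a a', b (purify_wire (Sample i t a) false) = None ->
     b (purify_wire (Sample i t a') false) = None -> a = a').
Proof. by apply: purify_chain => a /=; case: ifP. Qed.

Lemma sample_bottom i t a : b (purify_wire (Sample i t a) false) = None ->
  b (purify_wire (Unary i t) false) = None.
Proof.
case E: (b (purify_wire (Unary i t) false)) => [v|//].
by have [/(_ v E) ->] := sample_chain i t.
Qed.

(* Each coordinate spoils at most one sample: it has at most one impure unary
   bit, and the copies of that bit contain at most one impure one. *)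
Lemma card_pure_sample : #|I| < #|pure_sample b|.
Proof.
suff : #|~: pure_sample b| <= #|I|.
  by have := cardsC (pure_sample b); rewrite card_ord; lia.
pose blame a := odflt i0 [pick i | [exists t, b (purify_wire (Sample i t a) false) == None]].
have blameP a : a \in ~: pure_sample b ->
    exists t, b (purify_wire (Sample (blame a) t a) false) = None.
  rewrite !inE negb_forall => /existsP [i]; rewrite negb_forall => Hi.
  rewrite /blame; case: pickP => [j /existsP [t /eqP Ht]|/(_ i)]; first by exists t.
  move/negbT; rewrite negb_exists => /forallP Hall.
  by case/existsP: Hi => t; rewrite Hall.
rewrite -(card_in_imset (f := blame)) ?max_card // => a a' Ha Ha' Eblame.
have [t Ht] := blameP a Ha; have [t' Ht'] := blameP a' Ha'.
rewrite -Eblame in Ht'.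
have Et : t = t'.
  by have [_] := unary_chain (blame a); apply; apply: sample_bottom; eassumption.
rewrite -Et in Ht'.
by have [_] := sample_chain (blame a) t; apply.
Qed.

Definition base_point (i : I) : nat :=
  \sum_(t < M) (b (purify_wire (Unary i t) false) == Some true).

Lemma base_point_le i : base_point i <= M.
Proof.
rewrite -[X in _ <= X]card_ord -sum1_card; apply: leq_sum => t _; exact: leq_b1.
Qed.

Lemma sample_point_le a i : sample_point b a i <= M.
Proof.
rewrite -[X in _ <= X]card_ord -sum1_card; apply: leq_sum => t _; exact: leq_b1.
Qed.

(** Pure unary bits are copied unchanged to every sample. The only possible impure one counts 0 in
    the base point and 0 or 1 in a sample. *)
Lemma sample_in_cell a i :
  base_point i <= sample_point b a i <= (base_point i).+1.
Proof.
have same t : b (purify_wire (Unary i t) false) != None ->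
    b (purify_wire (Sample i t a) false) = b (purify_wire (Unary i t) false).
  case E: (b (purify_wire (Unary i t) false)) => [v|//] _.
  by have [/(_ v E) ->] := sample_chain i t.
rewrite /base_point /sample_point.
have [t0 /eqP Ht0|Hall] := pickP (fun t => b (purify_wire (Unary i t) false) == None).
  rewrite (bigD1 t0) //= [X in _ <= X <= _](bigD1 t0) //= Ht0 /=.
  have -> : \sum_(t | t != t0) (b (purify_wire (Sample i t a) false) == Some true)
      = \sum_(t | t != t0) (b (purify_wire (Unary i t) false) == Some true).
    apply: eq_bigr => t tt0; rewrite same //; apply: contraNneq tt0 => Ht.
    by have [_ H] := unary_chain i; apply/eqP/H.
  by rewrite add0n leq_addl -add1n leq_add2r leq_b1.
rewrite leq_eqVlt; apply/andP; split; [apply/orP; left; apply/eqP | apply: ltnW; rewrite ltnS].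
  by apply: eq_bigr => t _; rewrite same ?Hall.
by apply: leq_sum => t _; rewrite same ?Hall.
Qed.

Definition tally i v n : nat :=
  \sum_(a : sample | a < n) (b (oracle_wire i a) == Some v).

Lemma tally0 i v : tally i v 0 = 0.
Proof. by rewrite /tally big_pred0. Qed.

Lemma tallyS i v (a : sample) :
  tally i v a.+1 = (b (oracle_wire i a) == Some v) + tally i v a.
Proof.
rewrite /tally (bigD1 a) //=; congr (_ + _); apply: eq_bigl => c.
by rewrite ltnS [in RHS]ltn_neqAle andbC.
Qed.

Lemma tally_le i v (a : sample) : tally i v a <= a.
Proof.
have H n : n <= (2 * #|I|).+1 -> tally i v n <= n.
  elim: n => [|n IH] Hn; first by rewrite tally0.
  rewrite (tallyS i v (Ordinal Hn)) /=.
  by have := IH (ltnW Hn); case: (_ == _); lia.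
exact/H/ltnW/ltn_ord.
Qed.

Lemma neg_sample i a v : b (oracle_wire i a) = Some v ->
  b (nor_wire (NegSample i a)) = Some (~~ v).
Proof.
case: v => Hv; first by apply: nor_false; left.
by apply: nor_true; last exact: zero_false.
Qed.

(** NOR is 0 as soon as one input is 1, so enough ones force a cell to 1 and enough zeros force it
    to 0, whatever the impure values do. *)
Lemma threshold_cell i (a : sample) (h : level) :
  (h < tally i true a.+1 ->
     b (nor_wire (CellNor i a h)) = Some false /\ b (nor_wire (CellOr i a h)) = Some true) /\
  (a < tally i false a.+1 + h ->
     b (nor_wire (CellNor i a h)) = Some true /\ b (nor_wire (CellOr i a h)) = Some false).
Proof.
move Ea: (a : nat) => n; elim: n a Ea h => [|n IH] a Ea h.
  have Hone : tally i true a.+1 = (b (oracle_wire i a) == Some true).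
    by rewrite tallyS Ea tally0 addn0.
  have Hzero : tally i false a.+1 = (b (oracle_wire i a) == Some false).
    by rewrite tallyS Ea tally0 addn0.
  rewrite Ea in Hone Hzero *; rewrite Hone Hzero; split=> Hh.
  - have [Ho h0] : b (oracle_wire i a) = Some true /\ (h : nat) = 0.
      by move: Hh; case: eqP => [->|_]; case: (h : nat).
    have H : b (nor_wire (CellNor i a h)) = Some false.
      apply: nor_false; left; apply: nor_true => /=; first by rewrite (neg_sample Ho).
      by rewrite h0 /= zero_false.
    by split=> //; apply: nor_true => //; exact: zero_false.
  - have H : b (nor_wire (CellNor i a h)) = Some true.
      apply: nor_true; last by rewrite /= Ea /= zero_false.
      apply: nor_false => /=; case: eqP Hh => [Ho _|_ Hh].
        by left; rewrite (neg_sample Ho).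
      by right; rewrite Ea /= ifN ?one_true // -lt0n.
    by split=> //; apply: nor_false; left.
have Ep : ord_prev a = n :> nat by rewrite /= Ea.
have Ha v : tally i v a.+1 = (b (oracle_wire i a) == Some v) + tally i v n.+1.
  by rewrite tallyS Ea.
have Hle v : tally i v n.+1 <= n.+1 by have := tally_le i v a; rewrite Ea.
rewrite Ea in Ha *; rewrite !Ha; split=> Hh.
- have H : b (nor_wire (CellNor i a h)) = Some false.
    apply: nor_false; case: eqP Hh => [Ho|_] Hh /=; last first.
      by right; rewrite Ea /=; have [/(_ Hh) []] := IH _ Ep h.
    left; apply: nor_true => /=; first by rewrite (neg_sample Ho).
    have [_|h0] := eqVneq; first exact: zero_false.
    rewrite Ea /=; have [/(_ _) []] // := IH _ Ep (ord_prev h).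
    by rewrite /=; case: (nat_of_ord h) h0 Hh.
  by split=> //; apply: nor_true => //; exact: zero_false.
- have H : b (nor_wire (CellNor i a h)) = Some true.
    apply: nor_true => /=; last first.
      rewrite Ea /=; have [_ /(_ _) []] // := IH _ Ep h.
      by move: Hh; case: (_ == _) => /=; rewrite ?add0n ?add1n ?addSn ?ltnS // => /ltnW.
    apply: nor_false => /=; case: eqP Hh => [Ho _|_ Hh].
      by left; rewrite (neg_sample Ho).
    right; rewrite add0n in Hh; have [h0|h0] := eqVneq.
      by move: Hh; rewrite h0 addn0 ltnNge Hle.
    rewrite Ea /=; have [_ /(_ _) []] // := IH _ Ep (ord_prev h).
    by rewrite /=; case: (nat_of_ord h) h0 Hh => //= m _; rewrite addnS ltnS.
  by split=> //; apply: nor_false; left.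
Qed.

(** With [K = #|I|], the last cell asks for [K + 1] ones among [2K + 1] values, and [K + 1] zeros
    leave at most [K] ones. *)
Lemma threshold_out i v : #|I| < \sum_a (b (oracle_wire i a) == Some v) ->
  b (out_wire i) = Some v.
Proof.
have -> : \sum_a (b (oracle_wire i a) == Some v) = tally i v (@ord_max (2 * #|I|)).+1.
  by apply: eq_bigl => a; rewrite ltn_ord.
have [Ht Hf] := threshold_cell i ord_max ord_max.
case: v => Hv; first by have [] := Ht Hv.
by have [] := Hf _; first by move: Hv => /=; lia.
Qed.

Lemma oracle_value i a : a \in pure_sample b ->
  b (oracle_wire i a) = Some (f (sample_point b a) i).
Proof.
rewrite inE => /forallP Hpure.
have Hbit j t : b (purify_wire (Sample j t a) false)
    = Some (b (purify_wire (Sample j t a) false) == Some true).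
  by have /forallP /(_ t) := Hpure j; case: (b _) => [[]|].
pose bit (w : query_slot I M) := match w with
  | inl (j, t) => b (purify_wire (Sample j t a) false) == Some true
  | inr j => j == i end.
pose x : (arity circ).-tuple bool := [tuple bit (enum_val j) | j < #|{: query_slot I M}|].
have Hx w : slot_bit x w = bit w by rewrite /slot_bit tnth_mktuple enum_rankK.
have [_ _ /(_ (i, a) x) ->] := netlist_solution b_solution.
  rewrite /label_oracle; case: pickP => [j|/(_ i)]; rewrite Hx /= ?eqxx // => /eqP ->.
  congr (Some (f _ i)); apply: funext => j'.
  by apply: eq_bigr => t _; rewrite Hx.
move=> j; rewrite !tnth_mktuple /=.
case: (enum_val j) => [[j' t]|j'] /=; first by rewrite -Hbit.
by case: ifP => _; [exact: one_true | exact: zero_copy_false].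
Qed.

Lemma label_not_constant i v :
  exists2 a, a \in pure_sample b & f (sample_point b a) i != v.
Proof.
apply/exists_inP; apply: contraT; rewrite negb_exists_in => /forall_inP Hall.
have Hv a : a \in pure_sample b -> f (sample_point b a) i = v.
  by move=> /Hall; rewrite negbK => /eqP.
(* The pure samples outvote the others, and [v] then runs through both chains, which puts every
   sample on the face where the label is not [v]. *)
have Hout : b (out_wire i) = Some v.
  apply: threshold_out; apply: leq_trans card_pure_sample _.
  rewrite -sum1_card big_mkcond /=; apply: leq_sum => a _.
  by case: ifP => // Ha; rewrite oracle_value // Hv // eqxx.
have [a Ha] : exists a, a \in pure_sample b.
  by apply/card_gt0P; apply: leq_ltn_trans card_pure_sample.
have Hbit t : b (purify_wire (Sample i t a) false) = Some v.
  have [/(_ v Hout) H _] := unary_chain i.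
  by have [/(_ v (H t false)) ->] := sample_chain i t.
have [H0 H1] := f_border i (sample_point_le a).
have Hp : sample_point b a i = \sum_(t < M) v.
  by apply: eq_bigr => t _; rewrite Hbit; case: (v).
move: Hp (Hv a Ha) => {Hall Hv Hout Hbit}; case: v => /=; rewrite ?sum_nat_const ?card_ord ?muln1 ?muln0.
  by move/H1/negbTE ->.
by move/H0 ->.
Qed.

End Solution.

(** * The query bound and the choice of parameters *)

Lemma card_axis k : #|{: axis k}| = 2 * k + 2.
Proof. by rewrite card_sum card_prod !card_bool card_ord. Qed.

(** After fewer than [n] queries the path can be extended past all samples of the output; then
    [cell_escapes] contradicts [label_not_constant]. The budget is two vertices per query and two
    per sample. *)
Lemma query_lower_bound (A : algorithm) k pad n :
  solves_OraclePureCircuit A ->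
  2 * n + 2 * (2 * (2 * k + 2)).+1 < 2 ^ k ->
  exists L : oracle (gate_circuit 18 pad (inr true : axis k)),
    n <= num_queries (A _) L.
Proof.
set C := gate_circuit _ _ _ => A_solves Hn.
pose L l : oracle C := label_oracle (label l).
have L_local l l' x : agree_on (touched (query_point x)) l l' -> L l x = L l' x.
  by move=> Hl; rewrite /L /label_oracle; case: pickP => // i _; apply: label_agree.
have [|l1 [S1 [Hl1 _ _ Hc1 [H|Hrun]]]] :=
  answer_queries (point_of := @query_point _ _ _ _) L_local (A C) (n := n) (empty_path_known k).
- by rewrite cards0 add0n; apply: leq_ltn_trans Hn; apply: leq_addr.
- by exists (L l1).
set b := run (A C) (L l1) in Hrun.
pose ps := [seq sample_point b a | a <- enum 'I_(2 * #|{: axis k}|).+1].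
have Hps : size ps = (2 * (2 * k + 2)).+1 by rewrite size_map size_enum_ord card_axis.
have [|l2 [S2 [Hl2 _ Ha2 Htouched]]] := answer_points (ps := ps) Hl1.
  rewrite Hps; apply: leq_ltn_trans Hn.
  by rewrite leq_add2r; move: Hc1; rewrite cards0.
(* The algorithm cannot tell [l2] from [l1], so the same output has to solve both instances. *)
have b_solution : is_solution (L l2) b by rewrite -(Hrun _ Ha2); apply: A_solves.
have f_border p i : (forall i, p i <= 18) ->
    (p i = 0 -> label l2 p i) /\ (p i = 18 -> ~~ label l2 p i).
  exact: label_border.
have [wf2 end2 _ _ _] := Hl2.
pose pt (a : {a | a \in pure_sample b}) := sample_point b (val a).
have [|||i [v Hv]] := @cell_escapes k l2 _ pt (base_point b) wf2.
- exact: base_point_le.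
- by move=> a i; apply: sample_in_cell b_solution _ _.
- move=> a s; apply: contraNneq end2 => <-.
  have := Htouched (val a); rewrite Hps (nth_map ord0) ?size_enum_ord //.
  rewrite nth_ord_enum -card_axis => /(_ (ltn_ord _)) /subsetP.
  by apply; rewrite !inE; case: s; rewrite eqxx ?orbT.
have [a Ha] := label_not_constant f_border b_solution i v.
by rewrite -(Hv (exist _ a Ha)) eqxx.
Qed.

(** The cubic term comes from the [K] threshold circuits, each with [(2K + 1)(K + 1)] cells of three
    gates. *)
Lemma card_gate_circuit_le k : 0 < k ->
  #|node (gate_circuit 18 0 (inr true : axis k))| <= (16 * k) ^ 3.
Proof.
move=> k_gt0; rewrite card_gate_circuit /= card_axis.
case: k k_gt0 => // k _; rewrite !expnS expn0; nia.
Qed.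

Import Order.TTheory GRing.Theory Num.Theory.
Local Open Scope ring_scope.

Theorem mainTheorem3 (R : realType) :
  exists (c : R) (n0 : nat), 0 < c /\
    forall A : algorithm, solves_OraclePureCircuit A ->
    forall n : nat, (n0 <= n)%N ->
    exists (C : circuit) (L : oracle C),
      #|node C| = n /\
      2 `^ (c * n%:R `^ 3^-1) <= (num_queries (A C) L)%:R.
Proof.
(* For [k] maximal with [(16k)^3 <= n], the cube root of [n] is at most [32k], and the factor 1/64
   gives [k/2 <= k - 2]. *)
exists 64^-1, ((16 * 8) ^ 3)%N; split=> [|A A_solves n Hn]; first by rewrite invr_gt0 ltr0n.
have [k Hk kmax] : exists2 k, ((16 * k) ^ 3 <= n)%N &
    forall m, ((16 * m) ^ 3 <= n -> m <= k)%N.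
  have bounded m : ((16 * m) ^ 3 <= n -> m <= n)%N.
    apply: leq_trans; rewrite expnS; case: m => // m; nia.
  by case: (ex_maxnP (ex_intro _ 8%N Hn) bounded) => k; exists k.
have k8 : (8 <= k)%N := kmax _ Hn.
have n_lt : (n < (32 * k) ^ 3)%N.
  have : (n < (16 * k.+1) ^ 3)%N by rewrite ltnNge; apply/negP => /kmax; rewrite ltnn.
  by move/leq_trans; apply; rewrite leq_exp2r //; lia.
have card_le := leq_trans (card_gate_circuit_le (leq_trans (isT : 0 < 8)%N k8)) Hk.
set c0 := #|_| in card_le.
(* The queries use [2^(k-1)] vertices and the samples [8k + 10], which is below [2^(k-1)] from
   [k = 8] on. *)
have [|L HL] := @query_lower_bound A k (n - c0) (2 ^ (k - 2)) A_solves.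
  have -> : k = (k - 8 + 8)%N by rewrite subnK.
  move: (k - 8)%N => m; rewrite -addnBA // expnD [X in (_ < X)%N]expnD /=.
  have : (m < 2 ^ m)%N := ltn_expl m (ltnSn 1).
  by move: (2 ^ m)%N => p; rewrite !expnS expn0; lia.
exists (gate_circuit 18 (n - c0) (inr true : axis k)), L; split.
  rewrite card_gate_circuit; move: card_le; rewrite /c0 card_gate_circuit add0n => card_le.
  by rewrite subnK.
apply: (@le_trans _ _ (2 ^ (k - 2))%:R); last by rewrite ler_nat.
have root_le : n%:R `^ 3^-1 <= (32 * k)%:R :> R.
  have -> : (32 * k)%:R = ((32 * k) ^ 3)%:R `^ 3^-1 :> R.
    by rewrite natrX -powR_mulrn // -powRrM mulfV ?pnatr_eq0 // powRr1.
  by apply: ge0_ler_powR; rewrite ?nnegrE ?invr_ge0 ?ler0n // ler_nat ltnW.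
rewrite natrX -powR_mulrn //; apply: ler_powR; first by rewrite ler1n.
apply: le_trans (ler_wpM2l _ root_le) _; first by rewrite invr_ge0.
rewrite mulrC ler_pdivrMr ?ltr0n // -natrM ler_nat; lia.
Qed.
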